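(* Let $J$ be an indecomposable $W_n$-module in category $\mathcal{J}$. Then $J$ is a polynomial module. More precisely, there are $\lambda\in\mathbb{C}^n$ and a finite-dimensional subspace $U=J_\lambda$ of $J$ such that multiplication gives an isomorphism $\mathcal{F}(\mathbb{T}^n)\otimes U\cong J$. Define $D_j(s)\in\mathrm{End}\,U$ by $D_j(s)u=e_{-s}\,(d_j(s)u)$. Then for all $j=1,\dots,n$, $s,m\in\mathbb{Z}^n$ and $v\in U$, $$d_j(s)(e_m v)=e_{m+s}\big(m_j\,\mathrm{Id}+D_j(s)\big)v .$$ Moreover, the operators $D_j(s)$ depend polynomially on $s\in\mathbb{Z}^n$, and $D_j(0)=\lambda_j\,\mathrm{Id}$.
   Context: Let $n\ge 1$. Let $\mathcal{F}(\mathbb{T}^n)$ be the commutative algebra with $\mathbb{C}$-basis $e_m=e^{2\pi i m\cdot x}$, $m\in\mathbb{Z}^n$, and $e_me_k=e_{m+k}$. Let $W_n$ be the Lie algebra with $\mathbb{C}$-basis $d_j(s)=\frac{1}{2\pi i}e^{2\pi i s\cdot x}\frac{\partial}{\partial x^j}$, for $j=1,\dots,n$ and $s\in\mathbb{Z}^n$, and bracket $$[d_j(s),d_k(m)]=m_j\,d_k(s+m)-s_k\,d_j(s+m).$$ $W_n$ acts on $\mathcal{F}(\mathbb{T}^n)$ by derivations via $d_j(s)e_m=m_je_{m+s}$. Write $d_j=d_j(0)$. Category $\mathcal{J}$ consists of $W_n$-modules $J$ that are also $\mathcal{F}(\mathbb{T}^n)$-modules and satisfy: (J1) each $d_j$ acts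 diagonalizably on $J$; (J2) $J$ is a free $\mathcal{F}(\mathbb{T}^n)$-module of finite rank; (J3) $u(fw)=(uf)w+f(uw)$ for all $u\in W_n$, $f\in\mathcal{F}(\mathbb{T}^n)$, $w\in J$. For $\mu\in\mathbb{C}^n$, the weight space is $J_\mu=\{w\in J: d_jw=\mu_jw \text{ for all } j\}$. Submodules are subspaces invariant under both $W_n$ and $\mathcal{F}(\mathbb{T}^n)$. Indecomposable modules are nonzero. A module $J$ in $\mathcal{J}$ is a polynomial module if there is a basis $v_1,\dots,v_k$ of $J$ over $\mathcal{F}(\mathbb{T}^n)$ such that $$d_j(s)(e_mv_r)=\sum_{\ell}f_{jr\ell}(s,m)\,e_{m+s}v_\ell$$ with each $f_{jr\ell}$ a polynomial in $s,m\in\mathbb{Z}^n$. *)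

(* Defs.v *)
From HB Require Import structures.
From mathcomp Require Import all_boot all_algebra.
From mathcomp Require Import reals complex mpoly.
Set Implicit Arguments. Unset Strict Implicit. Unset Printing Implicit Defensive.
Import GRing.Theory.
Local Open Scope ring_scope.

(* Z^n is represented by integer row vectors 'rV[int]_n; coordinate j of s
   is  s 0 j.  A W_n-module / F(T^n)-module structure on a C-vector space V is
   given by the operators of the basis elements:
     E m       : action of e_m = e^{2 pi i m.x}   (m in Z^n)
     d j s     : action of d_j(s)                 (j < n, s in Z^n)
   both linear; the actions of general elements are their linear extensions. *)

Section JDefs.
Variables (C : fieldType) (n : nat) (V : lmodType C).
Variables (E : 'rV[int]_n -> {linear V -> V})
          (d : 'I_n -> 'rV[int]_n -> {linear V -> V}).

Definition zc (s : 'rV[int]_n) (j : 'I_n) : C := (s 0 j)%:~R.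

Definition F_module : Prop :=
  (forall v, E 0 v = v) /\ (forall m k v, E m (E k v) = E (m + k) v).

Definition W_module : Prop :=
  forall (j k : 'I_n) (s m : 'rV[int]_n) (v : V),
    d j s (d k m v) - d k m (d j s v)
    = zc m j *: d k (s + m) v - zc s k *: d j (s + m) v.

Definition diagonalizable (T : V -> V) : Prop :=
  forall v : V, exists s : seq (C * V),
    (forall p, p \in s -> T p.2 = p.1 *: p.2) /\ v = \sum_(p <- s) p.2.

Definition lin_indep (I : eqType) (f : I -> V) : Prop :=
  forall (s : seq I) (c : I -> C), uniq s ->
    \sum_(i <- s) c i *: f i = 0 -> forall i, i \in s -> c i = 0.

Definition spans (I : eqType) (f : I -> V) (P : V -> Prop) : Prop :=
  forall v, P v -> exists (s : seq I) (c : I -> C), v = \sum_(i <- s) c i *: f i.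

Definition is_basis (I : eqType) (f : I -> V) : Prop :=
  lin_indep f /\ spans f (fun _ => True).

(* v_1..v_k is a basis of V as an F(T^n)-module: since F(T^n) has C-basis
   (e_m)_m, this means (e_m v_r)_{m,r} is a C-basis of V *)
Definition F_basis (k : nat) (b : 'I_k -> V) : Prop :=
  is_basis (fun p : 'rV[int]_n * 'I_k => E p.1 (b p.2)).

Definition free_finite_rank : Prop := exists (k : nat) (b : 'I_k -> V), F_basis b.

(* (J3) Leibniz rule: u(f w) = (u f) w + f (u w), with d_j(s) e_m = m_j e_{m+s} *)
Definition leibniz : Prop :=
  forall (j : 'I_n) (s m : 'rV[int]_n) (w : V),
    d j s (E m w) = zc m j *: E (m + s) w + E m (d j s w).

Definition in_cat_J : Prop :=
  [/\ F_module, W_module, (forall j, diagonalizable (d j 0)),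
      free_finite_rank & leibniz].

Definition submodule (P : V -> Prop) : Prop :=
  [/\ P 0, (forall u v, P u -> P v -> P (u + v)),
      (forall (c : C) v, P v -> P (c *: v)),
      (forall m v, P v -> P (E m v)) &
      (forall j s v, P v -> P (d j s v))].

Definition zero_sub (P : V -> Prop) : Prop := forall v, P v -> v = 0.

Definition indecomposable : Prop :=
  (exists v : V, v <> 0) /\
  forall A B : V -> Prop, submodule A -> submodule B ->
    (forall v, A v -> B v -> v = 0) ->
    (forall v, exists a b, [/\ A a, B b & v = a + b]) ->
    zero_sub A \/ zero_sub B.

Definition weight_space (lam : 'I_n -> C) (v : V) : Prop :=
  forall j, d j 0 v = lam j *: v.

Definition polyfun2 (f : 'rV[int]_n -> 'rV[int]_n -> C) : Prop :=
  exists p : {mpoly C[n + n]},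
    forall s m, f s m = p.@[fun i => ((row_mx s m) 0 i)%:~R].

Definition polynomial_module : Prop :=
  exists (k : nat) (v : 'I_k -> V), F_basis v /\
  exists f : 'I_n -> 'I_k -> 'I_k -> 'rV[int]_n -> 'rV[int]_n -> C,
    (forall j r l, polyfun2 (f j r l)) /\
    forall j s m r,
      d j s (E m (v r)) = \sum_(l < k) f j r l s m *: E (m + s) (v l).

Definition Dop (j : 'I_n) (s : 'rV[int]_n) (u : V) : V := E (- s) (d j s u).

End JDefs.

(* Main.v *)
(* The fiber [U] carries operators [D_j(s)], and
   [(z^s - 1) d_j |-> D_j(s) - lam_j] is a finite-dimensional representation of
   the Lie algebra of vector fields on the torus (with Laurent polynomial
   coefficients) vanishing at the identity.  Put [x = z_i - 1] and
   [d/dx = z_i^(-1) d_i].  The fields [x^(a+1) d/dx] are eigenvectors of the Euler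
   field [x d/dx] with eigenvalue [a], so they act by zero for large [a].  The
   kernel is an ideal, and [[f d/dx, x g d/dx] - [x f d/dx, g d/dx] = 2 f g d/dx],
   so the kernel contains [x^N A d_i], where [A] is the algebra of Laurent
   polynomials; one more bracket gives [x^N A d_j] for all [j].  This says that
   the [N]-th difference of [D_j] in the direction [i] vanishes, for every [i],
   and hence [D_j] is polynomial by Newton's formula in each coordinate.

   The fiber itself comes from the weight decomposition: indecomposability
   leaves only one coset of weights modulo [Z^n]. *)
Require Import Defs.
From HB Require Import structures.
From mathcomp Require Import all_boot all_algebra.
From mathcomp Require Import reals complex mpoly.
From mathcomp Require Import ring boolp.
Set Implicit Arguments. Unset Strict Implicit.
Unset Printing Implicit Defensive.
Import GRing.Theory.
Local Open Scope ring_scope.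
Import Num.Theory.

(** * Polynomials in a shift operator *)

(** The identities below are linear in each polynomial, so it is enough to check them on
    monomials. *)
Lemma poly_linear_ind (C : nzRingType) (P : {poly C} -> Prop) :
  P 0 -> (forall c p q, P p -> P q -> P (c *: p + q)) ->
  (forall a, P 'X^a) -> forall p, P p.
Proof.
move=> P0 PD PX p; rewrite -[p]coefK poly_def.
by elim/big_rec: _ => // a q _ Pq; apply: PD.
Qed.

(* [p] acts on functions on [Z^n] as a polynomial in the shift by the [i]-th
   unit vector. *)
Definition polyshift (C : nzRingType) (n : nat) (W : lmodType C) (i : 'I_n)
    (p : {poly C}) (F : 'rV[int]_n -> W) (s : 'rV[int]_n) : W :=
  \sum_(a < size p) p`_a *: F (s + delta_mx 0 i *+ a).

Section PolyShift.
Variables (C : comNzRingType) (n : nat) (W : lmodType C) (i : 'I_n).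
Implicit Types (p q : {poly C}) (F : 'rV[int]_n -> W) (s : 'rV[int]_n).

Lemma polyshift_wide N p F s : (size p <= N)%N ->
  polyshift i p F s = \sum_(a < N) p`_a *: F (s + delta_mx 0 i *+ a).
Proof.
move=> le_pN; rewrite /polyshift.
rewrite (big_ord_widen N (fun a => p`_a *: F (s + delta_mx 0 i *+ a))) //.
rewrite big_mkcond; apply: eq_bigr => a _; case: ltnP => // le_pa.
by rewrite nth_default // scale0r.
Qed.

Lemma polyshiftP c p q F s :
  polyshift i (c *: p + q) F s = c *: polyshift i p F s + polyshift i q F s.
Proof.
set N := maxn (size p) (size q).
have le_pN : (size p <= N)%N by apply: leq_maxl.
have le_qN : (size q <= N)%N by apply: leq_maxr.
rewrite (polyshift_wide _ _ le_pN) (polyshift_wide _ _ le_qN).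
  rewrite (polyshift_wide (N := N)).
  rewrite scaler_sumr -big_split; apply: eq_bigr => a _ /=.
  by rewrite coefD coefZ scalerDl scalerA.
apply: leq_trans (size_polyD _ _) _; rewrite geq_max le_qN andbT.
exact: leq_trans (size_scale_leq _ _) le_pN.
Qed.

Lemma polyshift0 F s : polyshift i 0 F s = 0.
Proof. by rewrite /polyshift size_poly0 big_ord0. Qed.

Lemma polyshiftD p q F s :
  polyshift i (p + q) F s = polyshift i p F s + polyshift i q F s.
Proof. by rewrite -[p]scale1r polyshiftP !scale1r. Qed.

Lemma polyshiftZ c p F s : polyshift i (c *: p) F s = c *: polyshift i p F s.
Proof. by rewrite -[c *: p]addr0 polyshiftP polyshift0 addr0. Qed.

Lemma polyshiftB p q F s :
  polyshift i (p - q) F s = polyshift i p F s - polyshift i q F s.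
Proof. by rewrite polyshiftD -[- q]scaleN1r polyshiftZ scaleN1r. Qed.

Lemma polyshiftXn a F s : polyshift i 'X^a F s = F (s + delta_mx 0 i *+ a).
Proof.
rewrite /polyshift size_polyXn big_ord_recr big1 /= => [|b _].
  by rewrite coefXn eqxx scale1r add0r.
by rewrite coefXn (ltn_eqF (ltn_ord b)) scale0r.
Qed.

Lemma polyshift1 F s : polyshift i 1 F s = F s.
Proof. by rewrite -(expr0 'X) polyshiftXn mulr0n addr0. Qed.

Lemma polyshiftXM p F s :
  polyshift i ('X * p) F s = polyshift i p F (s + delta_mx 0 i).
Proof.
elim/poly_linear_ind: p => [|c p q IHp IHq|a].
- by rewrite mulr0 !polyshift0.
- by rewrite mulrDr -scalerAr !polyshiftP IHp IHq.
- by rewrite -exprS !polyshiftXn mulrS addrA.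
Qed.

End PolyShift.

(** * Brackets of vector fields with Laurent coefficients *)

Section Bracket.
Variables (C : numFieldType) (n k : nat).
Variables (M : 'I_n -> 'rV[int]_n -> 'M[C]_k).

Hypothesis bracketM : forall (j l : 'I_n) (s m : 'rV[int]_n),
  M j s *m M l m - M l m *m M j s =
  (m 0 j)%:~R *: (M l (s + m) - M l m) - (s 0 l)%:~R *: (M j (s + m) - M j s).

Variable i : 'I_n.
Let R j p s := polyshift i p (M j) s.
Let e : 'rV[int]_n := delta_mx 0 i.
Implicit Types (p q : {poly C}) (s m : 'rV[int]_n).

(* [(p, s)] stands for [p(z_i) z^s]; applying [d_j] gives
   [(coord_deriv j p s)(z_i) z^s]. *)
Definition coord_deriv (j : 'I_n) p s : {poly C} :=
  (j == i)%:R *: ('X * p^`()) + (s 0 j)%:~R *: p.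

Lemma coord_derivP j c p q s :
  coord_deriv j (c *: p + q) s = c *: coord_deriv j p s + coord_deriv j q s.
Proof.
rewrite /coord_deriv derivD derivZ -!mul_polyC; ring.
Qed.

Lemma coord_deriv0 j s : coord_deriv j 0 s = 0.
Proof. by rewrite /coord_deriv deriv0 mulr0 !scaler0 addr0. Qed.

Lemma coord_derivXn j a s :
  coord_deriv j 'X^a s = ((s + e *+ a) 0 j)%:~R *: 'X^a.
Proof.
have -> : (s + e *+ a) 0 j = s 0 j + (j == i)%:R *+ a.
  by rewrite !mxE mulmxnE mxE.
rewrite /coord_deriv derivXn rmorphD rmorphMn /= rmorph_nat.
case: a => [|a]; first by rewrite mulr0n mulr0 scaler0 add0r addr0.
by rewrite /= mulrnAr -exprS -scaler_nat scalerA -scalerDl addrC mulr_natr.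
Qed.

(** Both sides are bilinear in [p] and [q], and on monomials this is [bracketM]. The main terms come
    from the commutator of [p(z_i) z^s d_j] and [q(z_i) z^m d_l]; the corrections carry [p.[1]] or
    [q.[1]] and disappear for fields vanishing at the identity. *)
Lemma bracket_poly j l p q s m :
  R j p s *m R l q m - R l q m *m R j p s =
  (R l (p * coord_deriv j q m) (s + m) - p.[1] *: R l (coord_deriv j q m) m)
  - (R j (q * coord_deriv l p s) (s + m) - q.[1] *: R j (coord_deriv l p s) s).
Proof.
rewrite /R; elim/poly_linear_ind: p => [|c p p' IHp IHp'|a].
- rewrite coord_deriv0 mulr0 mul0r !polyshift0 hornerC.
  by rewrite mul0mx mulmx0 !scaler0 scale0r !subr0.
- move: (coord_deriv j q m) IHp IHp' => dq IHp IHp'.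
  rewrite coord_derivP mulrDl mulrDr -scalerAl -scalerAr 4!polyshiftP.
  rewrite mulmxDl mulmxDr -scalemxAl -scalemxAr hornerD hornerZ.
  rewrite opprD addrACA -scalerBr IHp IHp'.
  by apply/matrixP => u v; rewrite !mxE; ring.
elim/poly_linear_ind: q => [|c q q' IHq IHq'|b].
- rewrite coord_deriv0 mulr0 mul0r !polyshift0 hornerC.
  by rewrite mul0mx mulmx0 !scaler0 scale0r !subr0.
- move: (coord_deriv l _ s) IHq IHq' => dp IHq IHq'.
  rewrite coord_derivP mulrDl mulrDr -scalerAl -scalerAr (polyshiftP _ _ q).
  rewrite (polyshiftP _ _ (_ * _) (_ * _)) (polyshiftP _ _ (coord_deriv _ _ _)).
  rewrite (polyshiftP _ _ (q * dp)).
  rewrite mulmxDl mulmxDr -scalemxAl -scalemxAr hornerD hornerZ.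
  rewrite opprD addrACA -scalerBr IHq IHq'.
  by apply/matrixP => u v; rewrite !mxE; ring.
rewrite !coord_derivXn !hornerXn !expr1n !scale1r -!scalerAr -!exprD.
rewrite !polyshiftZ !polyshiftXn bracketM !scalerBr mulrnDr.
by rewrite -/e addrACA (addnC b a) mulrnDr.
Qed.

End Bracket.

(** Natural roots are split off one at a time, lowering the degree. In characteristic zero, a factor
    ['X - a] has no natural root above [a]. *)
Lemma natr_root_bound (C : numFieldType) (p : {poly C}) :
  p != 0 -> exists N, forall a, (N <= a)%N -> ~~ root p a%:R.
Proof.
have [n] := ubnP (size p); elim: n p => // n IHn p le_pn p_neq0.
have [[a pa]|npa] := pselect (exists a : nat, root p a%:R); last first.
  by exists 0%N => a _; apply/negP => pa; case: npa; exists a.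
have /factor_theorem[q def_p] := pa.
have q_neq0 : q != 0 by apply: contraNneq p_neq0 => q0; rewrite def_p q0 mul0r.
have [|N qN] := IHn q _ q_neq0.
  by move: le_pn; rewrite def_p size_Mmonic ?monicXsubC // size_XsubC addn2.
exists (maxn N a.+1) => b; rewrite geq_max => /andP[leNb ltab].
by rewrite def_p rootM negb_or qN //= root_XsubC eqr_nat gtn_eqF.
Qed.

(** A nonzero [Y a] is an eigenvector, with eigenvalue [a], of the commutator with [h]. That
    operator acts on a finite-dimensional space, so only finitely many naturals are eigenvalues. *)
Lemma ad_eigen_vanish (C : numFieldType) (k : nat) (h : 'M[C]_k)
    (Y : nat -> 'M[C]_k) :
  (forall a, h *m Y a - Y a *m h = a%:R *: Y a) ->
  exists N, forall a, (N <= a)%N -> Y a = 0.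
Proof.
move=> hY; pose A := lin_mulmx h - lin_mulmxr h : 'M[C]_(k * k).
have [N rootN] := natr_root_bound (monic_neq0 (char_poly_monic A)).
exists N => a /rootN; rewrite -eigenvalue_root_char => /eigenvalueP nYa.
apply/eqP; rewrite -mxvec_eq0; apply/negP => /negP Ya_neq0; case: nYa.
exists (mxvec (Y a)) => //.
by rewrite mulmxBr !mul_vec_lin /= -linearB hY linearZ.
Qed.

(** * The kernel of the finite-dimensional representation *)

Section Vanishing.
Variables (C : numFieldType) (n k : nat).
Variables (M : 'I_n -> 'rV[int]_n -> 'M[C]_k).

Hypothesis bracketM : forall (j l : 'I_n) (s m : 'rV[int]_n),
  M j s *m M l m - M l m *m M j s =
  (m 0 j)%:~R *: (M l (s + m) - M l m) - (s 0 l)%:~R *: (M j (s + m) - M j s).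

Variable i : 'I_n.
Let R j p s := polyshift i p (M j) s.
Let e : 'rV[int]_n := delta_mx 0 i.
Let x : {poly C} := 'X - 1.
Implicit Types (p q : {poly C}) (s m : 'rV[int]_n).

Lemma horner_subX1 : x.[1] = 0.
Proof. by rewrite hornerD hornerX hornerN hornerC subrr. Qed.

Lemma deriv_subX1_exp a : (x ^+ a.+1)^`() = a.+1%:R *: x ^+ a.
Proof. by rewrite deriv_exp derivB derivX derivC subr0 mul1r scaler_nat. Qed.

Lemma bracket_poly_ideal j l p q s m : p.[1] = 0 -> q.[1] = 0 ->
  R j p s *m R l q m - R l q m *m R j p s =
  R l (p * coord_deriv i j q m) (s + m) - R j (q * coord_deriv i l p s) (s + m).
Proof.
by move=> p1 q1; rewrite (bracket_poly bracketM) p1 q1 !scale0r !subr0.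
Qed.

Lemma coord_deriv_self p s :
  coord_deriv i i p s = 'X * p^`() + (s 0 i)%:~R *: p.
Proof. by rewrite /coord_deriv eqxx scale1r. Qed.

(* [x^(a+1) d/dx], with [x = z_i - 1] and [d/dx = z_i^(-1) d_i]; the Euler field
   is the case [a = 0]. *)
Let Y a := R i (x ^+ a.+1) (- e).

Lemma euler_eigen a : Y 0 *m Y a - Y a *m Y 0 = a%:R *: Y a.
Proof.
have xa1 b : (x ^+ b.+1).[1] = 0.
  by rewrite horner_exp horner_subX1 expr0n.
rewrite /Y bracket_poly_ideal //.
rewrite -polyshiftB !coord_deriv_self !deriv_subX1_exp.
have -> : (- e) 0 i = -1 by rewrite !mxE !eqxx.
(* The bracket carries [z^(-2e)]; its factor ['X] absorbs one [z^(-e)], which brings back [Y a]. *)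
transitivity (R i ('X * (a%:R *: x ^+ a.+1)) (- e - e)).
  congr (R i _ _); rewrite -[a.+1]addn1 natrD expr0 expr1 -!mul_polyC.
  by rewrite !rmorphD /= !rmorphN /= !rmorph1 !exprD expr1; ring.
by rewrite /R polyshiftXM polyshiftZ addrNK.
Qed.

Lemma polyshift_self_vanish :
  exists N, forall p s, R i (x ^+ N * p) s = 0.
Proof.
have [N YN] := ad_eigen_vanish euler_eigen.
pose g := x ^+ N.+1; have YN0 : R i g (- e) = 0 by apply: YN.
have YN1 : R i (x * g) (- e) = 0 by rewrite -exprS; apply: YN.
have x1 : x.[1] = 0 := horner_subX1.
have g1 : g.[1] = 0 by rewrite horner_exp x1 expr0n.
have pg p s : p.[1] = 0 -> R i (p * g) s = 0.
  move=> p1; have xp1 : (x * p).[1] = 0 by rewrite hornerM p1 mulr0.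
  have xg1 : (x * g).[1] = 0 by rewrite hornerM g1 mulr0.
  (* Each of the brackets of [p] with [x * g] and of [x * p] with [g] has an entry acting by
     zero. *)
  have := bracket_poly_ideal i i s (- e) p1 xg1.
  have := bracket_poly_ideal i i s (- e) xp1 g1.
  rewrite -/(R i _ _) -/(R i (x * g) _) -/(R i p _) -/(R i (x * p) _) YN0 YN1.
  rewrite !mulmx0 !mul0mx subrr => E1 E2.
  (* the difference of the two brackets is [2 z_i p g z^(s - e)] *)
  have {E1 E2} : R i (2%:R *: ('X * (p * g))) (s - e) = 0.
    rewrite -[RHS]subr0 {1}E2 E1 -!polyshiftB; congr (R i _ _).
    rewrite !coord_deriv_self !derivM derivB derivX derivC subr0.
    by rewrite -!mul_polyC rmorph_nat; ring.
  rewrite /R polyshiftZ polyshiftXM addrNK => /eqP.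
  by rewrite scaler_eq0 pnatr_eq0 => /eqP.
(* [N.+1] factors form [g]; the last one goes to [p], to make it vanish at 1. *)
exists N.+2 => p s; rewrite exprSr -mulrA mulrC.
by rewrite pg // hornerM x1 mul0r.
Qed.

Lemma polyshift_vanish :
  exists N, forall j s, R j (x ^+ N) s = 0.
Proof.
(* For [j != i], a field [x^(N+1) z^(s-e) d_i] in the kernel is bracketed with [x d_j]. The [d_i]
   part of the result is in the kernel again, which leaves [x^(N+1) z^s d_j]. The exponent [N.+1]
   makes the coefficient vanish at 1 even for [N = 0]. *)
have [N RN] := polyshift_self_vanish; exists N.+1 => j s.
have [->|ji] := eqVneq j i; first by rewrite exprSr RN.
have xN1 : (x ^+ N.+1).[1] = 0 by rewrite horner_exp horner_subX1 expr0n.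
have := bracket_poly_ideal i j (s - e) 0 xN1 horner_subX1.
rewrite -/(R i _ _) (_ : R i (x ^+ N.+1) (s - e) = 0); last first.
  by rewrite exprSr RN.
rewrite mul0mx mulmx0 subrr coord_deriv_self derivB derivX derivC subr0.
rewrite mxE scale0r addr0 mulr1 addr0 [in X in _ - X]/coord_deriv.
rewrite (negbTE ji) scale0r add0r -scalerAr -exprS exprSr.
rewrite [X in _ - X]polyshiftZ -/(R i _ _).
rewrite (_ : R i _ _ = 0); last by rewrite 2!exprSr -mulrA RN.
by rewrite scaler0 subr0 [_ * 'X]mulrC /R polyshiftXM addrNK.
Qed.

End Vanishing.

(** * Vanishing differences and polynomial functions *)

Definition fdiff (n : nat) (W : zmodType) (i : 'I_n) (F : 'rV[int]_n -> W) :
    'rV[int]_n -> W :=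
  fun s => F (s + delta_mx 0 i) - F s.

(** ['X] acts as the unit shift, hence ['X - 1] as the forward difference. *)
Lemma polyshift_fdiff (C : comNzRingType) (n : nat) (W : lmodType C) (i : 'I_n)
    (F : 'rV[int]_n -> W) N s :
  polyshift i (('X - 1) ^+ N) F s = iter N (fdiff i) F s.
Proof.
elim: N s => [|N IHN] s; first by rewrite expr0 polyshift1.
by rewrite exprS mulrBl mul1r polyshiftB polyshiftXM !IHN.
Qed.

Section FiniteDifferences.
Variables (n : nat) (W : zmodType).
Implicit Types (i j : 'I_n) (F : 'rV[int]_n -> W).

Lemma fdiff0 i N : iter N (fdiff i) (fun=> 0 : W) = fun=> 0.
Proof.
by elim: N => //= N ->; apply/funext => s; rewrite /fdiff subr0.
Qed.

Lemma fdiffC i j F : fdiff i (fdiff j F) = fdiff j (fdiff i F).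
Proof.
apply/funext => s; rewrite /fdiff (addrAC s) !opprD !opprK.
by rewrite -!addrA; congr (_ + _); rewrite addrCA.
Qed.

Lemma iter_fdiffC i j N k F :
  iter N (fdiff i) (iter k (fdiff j) F) = iter k (fdiff j) (iter N (fdiff i) F).
Proof.
elim: k => //= k <-; elim: N => //= N ->; exact: fdiffC.
Qed.

Definition zero_coord i (s : 'rV[int]_n) : 'rV[int]_n :=
  \row_j (if j == i then 0 else s 0 j).

(** The equation [F \o mask ks = F] expresses that [F] depends only on the coordinates in [ks]; the
    induction on the number of variables runs on it. *)
Definition mask (ks : seq 'I_n) (s : 'rV[int]_n) : 'rV[int]_n :=
  \row_j (if j \in ks then s 0 j else 0).

Lemma zero_coordD i s : zero_coord i (s + delta_mx 0 i) = zero_coord i s.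
Proof.
by apply/rowP => j; rewrite !mxE; case: eqVneq => // _; rewrite addr0.
Qed.

Lemma zero_coordD_neq i j s : j != i ->
  zero_coord i (s + delta_mx 0 j) = zero_coord i s + delta_mx 0 j.
Proof.
move=> ji; apply/rowP => l; rewrite !mxE.
by case: (eqVneq l i) => [->|//]; rewrite eq_sym (negbTE ji).
Qed.

Lemma fdiff_zero_coord i j N F : j != i ->
  iter N (fdiff j) (F \o zero_coord i) = iter N (fdiff j) F \o zero_coord i.
Proof.
move=> ji; elim: N => //= N ->; apply/funext => s.
by rewrite /fdiff /= zero_coordD_neq.
Qed.

Lemma fdiff_mask i ks N F : i \in ks -> F \o mask ks = F ->
  iter N (fdiff i) F \o mask ks = iter N (fdiff i) F.
Proof.
move=> ki Fks; elim: N => //= N IHN; apply/funext => s.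
set G := iter N _ _ in IHN *.
have GE u : G (mask ks u) = G u by rewrite -[RHS](congr1 (@^~ u) IHN).
rewrite /fdiff /= GE -(GE (s + _)); congr (G _ - _).
apply/rowP => j; rewrite !mxE; case: ifPn => // kj.
have -> : (j == i) = false by apply: contraNF kj => /eqP->.
by rewrite andbF addr0.
Qed.

Lemma mask_zero_coord i ks s : i \notin ks ->
  mask (i :: ks) (zero_coord i s) = zero_coord i (mask ks s).
Proof.
move=> ki; apply/rowP => j; rewrite !mxE in_cons.
by case: eqVneq.
Qed.

(** Invariance under one unit step extends to all integer multiples, in both directions, and [s]
    lies [s 0 i] steps from [zero_coord i s]. *)
Lemma shift_invariant i F (s : 'rV[int]_n) :
  fdiff i F = (fun=> 0) -> F s = F (zero_coord i s).
Proof.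
move=> dF.
have FS u : F (u + delta_mx 0 i) = F u.
  by apply/eqP; rewrite -subr_eq0; apply/eqP; move: (congr1 (@^~ u) dF).
have FZ (t : int) u : F (u + t *: delta_mx 0 i) = F u.
  elim/int_ind: t => [|t IHt|t IHt]; first by rewrite scale0r addr0.
    by rewrite intS [1 + _]addrC scalerDl scale1r addrA FS.
  rewrite -FS -addrA -{2}[delta_mx 0 i]scale1r -scalerDl intS opprD.
  by rewrite addrAC addNr add0r.
rewrite -[RHS](FZ (s 0 i)); congr F; apply/rowP => j; rewrite !mxE.
by case: eqVneq => [->|_]; rewrite ?mulr1 ?add0r ?mulr0 ?addr0.
Qed.

End FiniteDifferences.

Section Newton.
Variables (C : numFieldType) (n : nat).

(** The binomial coefficient of [t] over [k], as a product: it makes sense for negative [t] and is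
    visibly polynomial in [t]. *)
Definition binomial_fun (k : nat) (t : int) : C :=
  k`!%:R^-1 * \prod_(c < k) (t%:~R - c%:R).

Lemma binomial_fun0 t : binomial_fun 0 t = 1.
Proof. by rewrite /binomial_fun big_ord0 fact0 invr1 mulr1. Qed.

Lemma binomial_fun_at0 k : binomial_fun k.+1 0 = 0.
Proof. by rewrite /binomial_fun big_ord_recl subrr mul0r mulr0. Qed.

(** Pascal's rule. The two products share [k] factors; the remaining ones, [t + 1] and [t - k],
    differ by [k + 1], which cancels against the factorial. *)
Lemma binomial_funS k t :
  binomial_fun k.+1 (t + 1) - binomial_fun k.+1 t = binomial_fun k t.
Proof.
rewrite /binomial_fun -mulrBr big_ord_recl big_ord_recr /= intrD mulr1z.
under eq_bigr => c _ do rewrite /bump /= natrD opprD addrA addrK.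
rewrite subr0 [_ * (_ - k%:R)]mulrC -mulrBl mulrA; congr (_ * _).
have -> : t%:~R + 1 - (t%:~R - k%:R) = k.+1%:R :> C by rewrite -natr1; ring.
by rewrite factS natrM invfM mulrC mulrA mulfV ?mul1r // pnatr_eq0.
Qed.

Lemma newton_coord (i : 'I_n) N (f : 'rV[int]_n -> C) :
  iter N (fdiff i) f = (fun=> 0) ->
  forall s, f s = \sum_(k < N) binomial_fun k (s 0 i)
                    * iter k (fdiff i) f (zero_coord i s).
Proof.
elim: N f => [|N IHN] f; first by move=> /= -> s; rewrite big_ord0.
rewrite iterSr => /IHN df s; apply/eqP; rewrite -subr_eq0; apply/eqP.
(* The error [g] has zero difference in direction [i], by the induction hypothesis for [fdiff i f]
   and Pascal's rule. So it may be evaluated where coordinate [i] is 0, and there only the term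
   [k = 0] survives, which is [f] itself. *)
pose g u := f u - \sum_(k < N.+1) binomial_fun k (u 0 i)
                    * iter k (fdiff i) f (zero_coord i u).
have s0 : zero_coord i s 0 i = 0 by rewrite mxE eqxx.
have zz : zero_coord i (zero_coord i s) = zero_coord i s.
  by apply/rowP => j; rewrite !mxE; case: eqP.
rewrite -/(g s) (shift_invariant (i := i)) /g.
  rewrite big_ord_recl big1 => [|k _].
    by rewrite s0 zz binomial_fun0 mul1r addr0 subrr.
  by rewrite s0 binomial_fun_at0 mul0r.
apply/funext => u; rewrite /fdiff.
have -> (a b c c' : C) : a - b - (c - c') = (a - c) - (b - c') by ring.
apply/eqP; rewrite subr_eq0; apply/eqP; rewrite -[LHS]/(fdiff i f u) df.
rewrite zero_coordD !big_ord_recl !binomial_fun0 opprD addrACA subrr add0r.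
rewrite -sumrB; apply: eq_bigr => k _.
rewrite -mulrBl iterSr.
have -> : (u + delta_mx 0 i) 0 i = u 0 i + 1 by rewrite !mxE !eqxx.
by rewrite binomial_funS.
Qed.

Definition polyfun (f : 'rV[int]_n -> C) : Prop :=
  exists p : {mpoly C[n]}, forall s, f s = p.@[fun i => (s 0 i)%:~R].

Lemma polyfun_cst c : polyfun (fun=> c).
Proof. by exists c%:MP => s; rewrite mevalC. Qed.

Lemma polyfun_coord i : polyfun (fun s => (s 0 i)%:~R).
Proof. by exists 'X_i => s; rewrite mevalXU. Qed.

Lemma polyfunD f g : polyfun f -> polyfun g -> polyfun (fun s => f s + g s).
Proof. by case=> p fp [q gq]; exists (p + q) => s; rewrite mevalD fp gq. Qed.

Lemma polyfunM f g : polyfun f -> polyfun g -> polyfun (fun s => f s * g s).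
Proof. by case=> p fp [q gq]; exists (p * q) => s; rewrite mevalM fp gq. Qed.

Lemma polyfun_sum N (f : 'I_N -> 'rV[int]_n -> C) :
  (forall k, polyfun (f k)) -> polyfun (fun s => \sum_(k < N) f k s).
Proof.
move=> /choice[p fp]; exists (\sum_k p k) => s.
by rewrite raddf_sum; apply: eq_bigr => k _; rewrite fp.
Qed.

Lemma polyfun_prod N (f : 'I_N -> 'rV[int]_n -> C) :
  (forall k, polyfun (f k)) -> polyfun (fun s => \prod_(k < N) f k s).
Proof.
move=> /choice[p fp]; exists (\prod_k p k) => s.
by rewrite rmorph_prod; apply: eq_bigr => k _; rewrite fp.
Qed.

Lemma polyfun_binomial k i : polyfun (fun s => binomial_fun k (s 0 i)).
Proof.
apply: polyfunM; first exact: polyfun_cst.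
apply: polyfun_prod => c; apply: polyfunD; first exact: polyfun_coord.
exact: polyfun_cst.
Qed.

(** Newton's formula in the first variable has coefficients that no longer depend on it and still
    have vanishing differences in the others, so the induction hypothesis applies to them. *)
Lemma fdiff_polyfun_mask N (ks : seq 'I_n) (f : 'rV[int]_n -> C) :
  uniq ks -> (forall i, i \in ks -> iter N (fdiff i) f = fun=> 0) ->
  f \o mask ks = f -> polyfun f.
Proof.
elim: ks f => [|i ks IHks] f /=.
  move=> _ _ f0; rewrite (_ : f = fun=> f 0); first exact: polyfun_cst.
  apply/funext => s; rewrite -[LHS](congr1 (@^~ s) f0) /=.
  by congr f; apply/rowP => j; rewrite !mxE.
move=> /andP[ki uks] df fks.
rewrite (funext (newton_coord (df i (mem_head _ _)))).
apply: polyfun_sum => k; apply: polyfunM; first exact: polyfun_binomial.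
apply: IHks => // [j kj|].
  have ji : j != i by apply: contraNneq ki => <-.
  rewrite (fdiff_zero_coord N (iter k (fdiff i) f) ji) iter_fdiffC.
  rewrite df ?fdiff0 //.
  by rewrite in_cons kj orbT.
apply/funext => s /=; rewrite -mask_zero_coord //.
have E := fdiff_mask k (mem_head i ks) fks.
exact: (congr1 (@^~ (zero_coord i s)) E).
Qed.

Lemma fdiff_polyfun (f : 'rV[int]_n -> C) :
  (forall i, exists N, iter N (fdiff i) f = fun=> 0) -> polyfun f.
Proof.
move=> /choice[N df].
(* Once a difference vanishes, so do all higher ones; the maximum serves all directions. *)
apply: (@fdiff_polyfun_mask (\max_i N i) (enum 'I_n)) => [|i _|].
- exact: enum_uniq.
- by rewrite -(subnK (leq_bigmax i)) iterD df fdiff0.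
- by apply/funext => s /=; congr f; apply/rowP => j; rewrite mxE mem_enum.
Qed.

End Newton.

Lemma fdiff_mx_entry (C : nzRingType) (n k : nat) (i : 'I_n)
    (M : 'rV[int]_n -> 'M[C]_k) a b N :
  iter N (fdiff i) (fun s => M s a b) = fun s => iter N (fdiff i) M s a b.
Proof.
by elim: N => //= N ->; apply/funext => s; rewrite /fdiff !mxE.
Qed.

Lemma bracket_polyfun (C : numFieldType) (n k : nat)
    (M : 'I_n -> 'rV[int]_n -> 'M[C]_k) :
  (forall (j l : 'I_n) (s m : 'rV[int]_n),
    M j s *m M l m - M l m *m M j s =
    (m 0 j)%:~R *: (M l (s + m) - M l m) -
    (s 0 l)%:~R *: (M j (s + m) - M j s)) ->
  forall j a b, polyfun (fun s => M j s a b).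
Proof.
move=> bracketM j a b; apply: fdiff_polyfun => i.
have [N RN] := polyshift_vanish bracketM i; exists N.
by rewrite fdiff_mx_entry; apply/funext => s; rewrite -polyshift_fdiff RN mxE.
Qed.

(** * Weights *)

Lemma big_regroup (V : nmodType) (A B : eqType) (g : B -> A) (F : B -> V)
    (s : seq B) :
  \sum_(p <- s) F p =
  \sum_(c <- undup (map g s)) \sum_(p <- s | g p == c) F p.
Proof.
under [RHS]eq_bigr do rewrite big_mkcond.
rewrite exchange_big; apply: eq_big_seq => p sp.
rewrite (bigD1_seq (g p)) ?undup_uniq ?mem_undup ?map_f //= eqxx.
rewrite big1 ?addr0 // => c; rewrite eq_sym => /negbTE-> //.
Qed.

Section Sums.
Variables (C : fieldType) (V : lmodType C).
Implicit Types (P Q : V -> Prop) (v w : V).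

Definition sumset P v : Prop :=
  exists2 s : seq V, (forall w, w \in s -> P w) & v = \sum_(w <- s) w.

Lemma sumset_in P v : P v -> sumset P v.
Proof.
by exists [:: v]; rewrite ?big_seq1 // => w; rewrite inE => /eqP->.
Qed.

Lemma sumset0 P : sumset P 0.
Proof. by exists [::]; rewrite ?big_nil. Qed.

Lemma sumsetD P v w : sumset P v -> sumset P w -> sumset P (v + w).
Proof.
case=> s sP -> [t tP ->]; exists (s ++ t); rewrite ?big_cat // => x.
by rewrite mem_cat => /orP[/sP|/tP].
Qed.

Lemma sumset_ind P Q : Q 0 -> (forall v w, Q v -> Q w -> Q (v + w)) ->
  (forall v, P v -> Q v) -> forall v, sumset P v -> Q v.
Proof.
move=> Q0 QD PQ v [s sP ->]; rewrite big_seq.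
by elim/big_ind: _ => // w /sP/PQ.
Qed.

(** Terms with the same label are added up, which stays inside [Q i], and zero totals are
    dropped. *)
Lemma sumset_label (I : eqType) (Q : I -> V -> Prop) v :
  (forall i, Q i 0) -> (forall i v w, Q i v -> Q i w -> Q i (v + w)) ->
  sumset (fun w => exists i, Q i w) v ->
  exists s : seq (I * V), [/\ uniq (map fst s),
    forall p, p \in s -> Q p.1 p.2 /\ p.2 <> 0 & v = \sum_(p <- s) p.2].
Proof.
move=> Q0 QD Qv.
have [s sQ ->] : exists2 s : seq (I * V),
    (forall p, p \in s -> Q p.1 p.2) & v = \sum_(p <- s) p.2.
  elim/sumset_ind: v / Qv => [|_ _ [s sQ ->] [t tQ ->]|v [i Qv]].
  - by exists [::]; rewrite ?big_nil.
  - exists (s ++ t); rewrite ?big_cat // => p.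
    by rewrite mem_cat => /orP[/sQ|/tQ].
  - by exists [:: (i, v)]; rewrite ?big_seq1 // => p; rewrite inE => /eqP->.
pose f i := (i, \sum_(p <- s | p.1 == i) p.2).
pose t := [seq f i | i <- undup (map fst s)].
exists [seq p <- t | p.2 != 0]; split.
- apply: subseq_uniq (map_subseq _ (filter_subseq _ _)) _.
  by rewrite -map_comp map_id undup_uniq.
- move=> p; rewrite mem_filter => /andP[/eqP p_neq0 /mapP[i _ def_p]].
  split=> //; rewrite def_p /= big_seq_cond.
  by elim/big_ind: _ => // [|q /andP[/sQ Qq /eqP<-]] //; apply: QD.
rewrite big_filter [RHS]big_mkcond big_map (big_regroup fst).
by apply: eq_bigr => i _ /=; case: eqP.
Qed.

(* Distinct weights are separated by some [T j]; [T j - w a j] kills the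
   component of weight [a] and rescales the others. *)
Lemma weight_sep (J : Type) (I : eqType) (T : J -> {linear V -> V})
    (w : I -> J -> C) (W : V -> Prop) :
  (forall u v, W u -> W v -> W (u + v)) ->
  (forall c v, W v -> W (c *: v)) ->
  (forall j v, W v -> W (T j v)) ->
  (forall a b, a <> b -> exists j, w a j <> w b j) ->
  forall s : seq (I * V), uniq (map fst s) ->
  (forall p, p \in s -> forall j, T j p.2 = w p.1 j *: p.2) ->
  W (\sum_(p <- s) p.2) -> forall p, p \in s -> W p.2.
Proof.
move=> WD WZ WT sep s; have [N] := ubnP (size s).
elim: N s => // N IHN [|[a v] s] //= le_sN /andP[a_s us] sT Wsum.
have Ws p : p \in s -> W p.2.
  move=> sp; have [|j neq_j] := sep p.1 a.
    by move=> pa; case/negP: a_s; rewrite -pa map_f.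
  pose f (q : I * V) := (q.1, (w q.1 j - w a j) *: q.2).
  have Wf : W (f p).2.
    apply: (IHN [seq f q | q <- s]); rewrite ?size_map ?map_f //.
    - by rewrite -map_comp.
    - move=> _ /mapP[q sq ->] l /=.
      by rewrite linearZ /= sT ?inE ?sq ?orbT // !scalerA mulrC.
    have -> : \sum_(q <- [seq f q | q <- s]) q.2 =
        T j (\sum_(q <- (a, v) :: s) q.2)
        + (- w a j) *: \sum_(q <- (a, v) :: s) q.2.
      rewrite big_map !big_cons linearD scalerDr addrACA.
      rewrite (sT (a, v)) ?mem_head //= scaleNr subrr add0r.
      rewrite linear_sum scaler_sumr -big_split; apply: eq_big_seq => q sq.
      by rewrite /= sT ?inE ?sq ?orbT // -scalerDl.
    by apply: WD; [apply: WT | apply: WZ].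
  move/(WZ (w p.1 j - w a j)^-1): Wf; rewrite scalerA mulVf ?scale1r //.
  by rewrite subr_eq0; apply/eqP.
move=> p; rewrite inE => /orP[/eqP->|/Ws //] /=.
(* The remaining component is the total minus the components already known to lie in [W]. *)
have -> : v = \sum_(q <- (a, v) :: s) q.2 + -1 *: \sum_(q <- s) q.2.
  by rewrite big_cons scaleN1r addrK.
apply: (WD) => //; apply: (WZ); rewrite big_seq; elim/big_ind: _ => //.
by rewrite -(scale0r (\sum_(q <- (a, v) :: s) q.2)); apply: WZ.
Qed.

(** Operators are added one at a time. A joint eigenvector of the earlier ones splits under the new
    [T k]; by commutation their joint eigenspace is stable under [T k], so [weight_sep] keeps the
    pieces inside it. *)
Lemma joint_diagonalization (J : finType) (T : J -> {linear V -> V}) :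
  (forall i j v, T i (T j v) = T j (T i v)) ->
  (forall j, Defs.diagonalizable (T j)) ->
  forall v, sumset (fun w => exists mu : {ffun J -> C},
                      forall j, T j w = mu j *: w) v.
Proof.
move=> TC Td v.
suff: forall (ks : seq J) v, sumset (fun w => exists mu : {ffun J -> C},
    forall j, j \in ks -> T j w = mu j *: w) v.
  move=> /(_ (enum J) v); elim/sumset_ind => [|u w|w [mu muP]].
  - exact: sumset0.
  - exact: sumsetD.
  - by apply: sumset_in; exists mu => j; apply: muP; rewrite mem_enum.
elim=> [|k ks IHks] u; first by apply: sumset_in; exists [ffun=> 0].
elim/sumset_ind: u / (IHks u) => [|u w|u [mu muP]].
- exact: sumset0.
- exact: sumsetD.
have [|||s [us sT def_u]] :=
    @sumset_label C (fun c w => T k w = c *: w) u.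
- by move=> c; rewrite linear0 scaler0.
- by move=> c x y Tx Ty; rewrite linearD Tx Ty scalerDr.
- have [t [tT ->]] := Td k u; rewrite big_seq.
  elim/big_ind: _ => [|x y|p tp]; [exact: sumset0|exact: sumsetD|].
  by apply: sumset_in; exists p.1; apply: tT.
have sW p : p \in s -> forall j, j \in ks -> T j p.2 = mu j *: p.2.
  move: p; pose W x := forall j, j \in ks -> T j x = mu j *: x.
  (* Only [T k] has to separate the pieces, hence the one-point index type. *)
  apply: (@weight_sep unit C (fun=> T k) (fun c _ => c) W) => //.
  - by move=> x y Wx Wy j kj; rewrite linearD Wx // Wy // scalerDr.
  - by move=> c x Wx j kj; rewrite linearZ /= Wx // !scalerA mulrC.
  - by move=> _ x Wx j kj; rewrite TC Wx // linearZ.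
  - by move=> p /sT[].
  - by rewrite -def_u.
exists (map snd s); last by rewrite big_map.
move=> _ /mapP[p sp ->]; exists [ffun j => if j == k then p.1 else mu j] => j.
rewrite inE ffunE; case: eqP => [-> _|_ /= /(sW p sp)//].
by have [] := sT p sp.
Qed.

End Sums.

(** * Spans and bases of finite lists *)

Section LinearSpan.
Variables (C : fieldType) (V : lmodType C).
Implicit Types (t l : seq V) (v w : V).

(** Coefficients are functions on [nat], so that removing the head of the list is reindexing by
    [.+1]. *)
Definition lspan t v : Prop :=
  exists c : nat -> C, v = \sum_(a < size t) c a *: t`_a.

Definition lfree t : Prop :=
  forall c : nat -> C, \sum_(a < size t) c a *: t`_a = 0 ->
  forall a, (a < size t)%N -> c a = 0.

Lemma lspan0 t : lspan t 0.
Proof. by exists (fun=> 0); rewrite big1 // => a _; rewrite scale0r. Qed.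

Lemma lspanD t v w : lspan t v -> lspan t w -> lspan t (v + w).
Proof.
case=> c -> [c' ->]; exists (fun a => c a + c' a).
by rewrite -big_split; apply: eq_bigr => a _; rewrite /= scalerDl.
Qed.

Lemma lspanZ t c v : lspan t v -> lspan t (c *: v).
Proof.
case=> c' ->; exists (fun a => c * c' a).
by rewrite scaler_sumr; apply: eq_bigr => a _; rewrite scalerA.
Qed.

Lemma lspan_sum t (I : Type) (r : seq I) (P : pred I) (F : I -> V) :
  (forall i, P i -> lspan t (F i)) -> lspan t (\sum_(i <- r | P i) F i).
Proof.
move=> tF; elim/big_ind: _ => // [|u v]; [exact: lspan0|exact: lspanD].
Qed.

Lemma mem_lspan t v : v \in t -> lspan t v.
Proof.
move=> tv; have lt_i : (index v t < size t)%N by rewrite index_mem.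
exists (fun a => (a == index v t)%:R).
rewrite (bigD1 (Ordinal lt_i)) //= eqxx scale1r nth_index //.
rewrite big1 ?addr0 // => a.
by rewrite -val_eqE /= => /negbTE->; rewrite scale0r.
Qed.

Lemma lspan_trans t l v :
  (forall w, w \in l -> lspan t w) -> lspan l v -> lspan t v.
Proof.
by move=> tl [c ->]; apply: lspan_sum => a _; apply/lspanZ/tl/mem_nth.
Qed.

(** A vector is kept only if it is outside the span of those kept so far; a relation with nonzero
    coefficient on it could be solved for it. *)
Lemma lspan_basis l : exists t,
  [/\ {subset t <= l}, lfree t & forall v, v \in l -> lspan t v].
Proof.
elim: l => [|x l [t [tl t_free lt]]]; first by exists [::].
have [tx|ntx] := pselect (lspan t x).
  exists t; split=> // [v /tl|v]; rewrite inE; first by move->; rewrite orbT.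
  by case/orP=> [/eqP->|/lt].
exists (x :: t); split.
- by move=> v; rewrite !inE => /orP[->//|/tl->]; rewrite orbT.
- move=> c; rewrite big_ord_recl /= => c0.
  have c00 : c 0%N = 0.
    apply/eqP/negPn/negP => c0_neq0; case: ntx.
    rewrite -[x](scalerK c0_neq0); apply: lspanZ.
    rewrite -[c 0%N *: x]opprK (addr0_eq c0) -scaleN1r; apply: lspanZ.
    by exists (fun a => c a.+1).
  move: c0; rewrite c00 scale0r add0r => /(t_free (fun a => c a.+1)) ct.
  by case.
move=> v; rewrite inE => /orP[/eqP->|/lt [c ->]].
  exact/mem_lspan/mem_head.
apply: lspan_sum => a _; apply/lspanZ/mem_lspan.
by rewrite inE mem_nth ?orbT.
Qed.

End LinearSpan.

(** * Weights of a module in the category and their cosets *)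

Section JetModule.
Variables (C : numFieldType) (n : nat) (V : lmodType C).
Variables (E : 'rV[int]_n -> {linear V -> V})
          (d : 'I_n -> 'rV[int]_n -> {linear V -> V}).
Hypothesis JV : in_cat_J E d.
Implicit Types (v w : V) (s m : 'rV[int]_n) (mu lam : 'I_n -> C).

Let EE m k v : E m (E k v) = E (m + k) v.
Proof. by have [[_ ->]] := JV. Qed.

Let E0 v : E 0 v = v.
Proof. by have [[->]] := JV. Qed.

Let dE j s m v : d j s (E m v) = zc C m j *: E (m + s) v + E m (d j s v).
Proof. by have [_ _ _ _ ->] := JV. Qed.

Let dd (j k : 'I_n) s m v : d j s (d k m v) =
  d k m (d j s v) + zc C m j *: d k (s + m) v - zc C s k *: d j (s + m) v.
Proof.
have [_ W _ _ _] := JV; move: (W j k s m v) => /eqP.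
by rewrite subr_eq addrC addrA => /eqP.
Qed.

Lemma E_inv m v : E (- m) (E m v) = v.
Proof. by rewrite EE addNr E0. Qed.

Definition wshift lam m : 'I_n -> C := fun j => lam j + zc C m j.

Lemma wshiftD lam m s : wshift lam (m + s) = wshift (wshift lam m) s.
Proof.
by apply/funext => j; rewrite /wshift /zc mxE rmorphD addrA.
Qed.

Lemma wshift0 lam : wshift lam 0 = lam.
Proof. by apply/funext => j; rewrite /wshift /zc mxE addr0. Qed.

(** Characteristic zero: distinct integers stay distinct in [C]. *)
Lemma wshift_inj lam m s : m <> s -> exists j, wshift lam m j <> wshift lam s j.
Proof.
move=> ms; apply/not_existsP => eqms; apply: ms; apply/rowP => j.
have /addrI/eqP := contrapT (eqms j); rewrite eqr_int => /eqP//.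
Qed.

Lemma weight_spaceD mu v w :
  weight_space d mu v -> weight_space d mu w -> weight_space d mu (v + w).
Proof. by move=> Uv Uw j; rewrite linearD Uv Uw scalerDr. Qed.

Lemma weight_spaceZ mu c v : weight_space d mu v -> weight_space d mu (c *: v).
Proof. by move=> Uv j; rewrite linearZ /= Uv !scalerA mulrC. Qed.

Lemma weight_space0 mu : weight_space d mu 0.
Proof. by move=> j; rewrite linear0 scaler0. Qed.

Lemma weight_space_sum mu (I : Type) (r : seq I) (P : pred I) (F : I -> V) :
  (forall i, P i -> weight_space d mu (F i)) ->
  weight_space d mu (\sum_(i <- r | P i) F i).
Proof.
move=> UF; elim/big_ind: _ => // [|u v].
  exact: weight_space0.
exact: weight_spaceD.
Qed.

Lemma weight_space_E mu m v :
  weight_space d mu v -> weight_space d (wshift mu m) (E m v).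
Proof.
by move=> Uv j; rewrite dE addr0 Uv linearZ /= -scalerDl addrC.
Qed.

Lemma weight_space_d mu k s v :
  weight_space d mu v -> weight_space d (wshift mu s) (d k s v).
Proof.
move=> Uv j; rewrite dd Uv linearZ /= add0r -scalerDl.
by rewrite [zc C 0 k]/zc mxE scale0r subr0.
Qed.

Lemma weight_decomposition v : sumset (fun w => exists mu : {ffun 'I_n -> C},
  weight_space d mu w) v.
Proof.
have [_ _ diag_d _ _] := JV.
apply: joint_diagonalization => [i j w|//]; rewrite dd /zc !mxE !scale0r.
by rewrite addr0 subr0.
Qed.

Lemma weight_indep (I : eqType) (w : I -> 'I_n -> C) (s : seq (I * V)) :
  (forall a b, a <> b -> exists j, w a j <> w b j) ->
  uniq (map fst s) -> (forall p, p \in s -> weight_space d (w p.1) p.2) ->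
  \sum_(p <- s) p.2 = 0 -> forall p, p \in s -> p.2 = 0.
Proof.
move=> sep us sU.
apply: (weight_sep (W := eq^~ 0) (T := fun j => d j 0)) sU => //.
- by move=> u v -> ->; rewrite addr0.
- by move=> c u ->; rewrite scaler0.
- by move=> j u ->; rewrite linear0.
Qed.

Definition coset lam mu : Prop := exists m, mu = wshift lam m.

(** Weights are finite functions here because labels need decidable equality; [coset_sum_in] hides
    the conversion. *)
Definition coset_sum (P : ('I_n -> C) -> Prop) : V -> Prop :=
  sumset (fun w => exists2 mu : {ffun 'I_n -> C}, P mu & weight_space d mu w).

Lemma coset_sum_in (P : ('I_n -> C) -> Prop) mu v :
  P mu -> weight_space d mu v -> coset_sum P v.
Proof.
move=> Pmu Uv; have def_mu : [ffun j => mu j] = mu :> ('I_n -> C).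
  by apply/funext => j; rewrite ffunE.
by apply: sumset_in; exists [ffun j => mu j]; rewrite def_mu.
Qed.

(** Both [e_m] and [d_j(s)] move weights by integer vectors. *)
Lemma coset_sum_submodule (P : ('I_n -> C) -> Prop) :
  (forall mu m, P mu -> P (wshift mu m)) -> submodule E d (coset_sum P).
Proof.
move=> Pshift.
have lin (f : {linear V -> V}) : (forall mu v, P mu -> weight_space d mu v ->
    coset_sum P (f v)) -> forall v, coset_sum P v -> coset_sum P (f v).
  move=> Pf v; elim/sumset_ind => [|u w Pu Pw|u [mu Pmu Uu]].
  - by rewrite linear0; exact: sumset0.
  - by rewrite linearD; exact: sumsetD.
  - exact: Pf Pmu Uu.
split=> [|u v|c|m|j s].
- exact: sumset0.
- exact: sumsetD.
- apply: (lin (c \*: idfun)) => mu v Pmu Uv.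
  exact/(coset_sum_in Pmu)/weight_spaceZ.
- apply: lin => mu v Pmu Uv; apply: coset_sum_in (weight_space_E m Uv).
  exact: Pshift.
- apply: lin => mu v Pmu Uv; apply: coset_sum_in (weight_space_d j s Uv).
  exact: Pshift.
Qed.

Lemma coset_sum_label (P : ('I_n -> C) -> Prop) v : coset_sum P v ->
  exists s : seq ({ffun 'I_n -> C} * V), [/\ uniq (map fst s),
    forall p, p \in s -> P p.1 /\ weight_space d p.1 p.2 &
    v = \sum_(p <- s) p.2].
Proof.
(* [sumset_label] wants 0 under every label, also outside [P]; the alternative [w = 0] allows it,
   and such entries are discarded at the end. *)
move=> Pv; pose Q (mu : {ffun 'I_n -> C}) w :=
  weight_space d mu w /\ (P mu \/ w = 0).
have [|||s [us sQ ->]] := @sumset_label _ _ _ Q v.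
- by move=> mu; split; [exact: weight_space0 | right].
- move=> mu u w [Uu Pu] [Uw Pw]; split; first exact: weight_spaceD.
  case: Pu => [Pmu|->]; first by left.
  by rewrite add0r.
- elim/sumset_ind: v / Pv => [|u w|w [mu Pmu Uw]].
  + exact: sumset0.
  + exact: sumsetD.
  + by apply: sumset_in; exists mu; split=> //; left.
by exists s; split=> // p /sQ[[Up [|]]].
Qed.

(** The module is the direct sum of the part with weights in one coset and the part with all other
    weights. The first contains a nonzero weight vector, so the second is zero. *)
Lemma single_coset : indecomposable E d ->
  exists lam, forall v, coset_sum (coset lam) v.
Proof.
case=> [[v0 v0_neq0] indec].
have [lam [w0 [Uw0 w0_neq0]]] : exists lam w, weight_space d lam w /\ w <> 0.
  apply: contrapT => none; apply: v0_neq0.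
  elim/sumset_ind: v0 / (weight_decomposition v0) => // [u w -> ->|w [mu Uw]].
    by rewrite addr0.
  by apply: contrapT => w_neq0; apply: none; exists mu, w.
exists lam.
have shiftC mu m : coset lam mu -> coset lam (wshift mu m).
  by case=> k ->; exists (k + m); rewrite wshiftD.
have shiftN mu m : ~ coset lam mu -> ~ coset lam (wshift mu m).
  move=> nmu /(shiftC _ (- m)); rewrite -wshiftD subrr wshift0.
  exact: nmu.
have [||||A0 v|B0 v] := indec (coset_sum (coset lam))
    (coset_sum (fun mu => ~ coset lam mu)).
- exact: coset_sum_submodule.
- exact: coset_sum_submodule.
- move=> v /coset_sum_label[s [us sP ->]] /coset_sum_label[t [ut tP def_v]].
  rewrite big_seq big1 // => p sp.
  (* A common element gives a relation between weight vectors: one expansion minus the other, with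
     disjoint sets of weights. *)
  pose t' := [seq (q.1, - q.2) | q <- t].
  have fst_t' : map fst t' = map fst t by rewrite -map_comp.
  apply: (@weight_indep _ (fun mu : {ffun 'I_n -> C} => mu) (s ++ t')).
  + move=> a b ab; apply/not_existsP => eqab; apply: ab; apply/ffunP => j.
    exact: contrapT (eqab j).
  + rewrite map_cat cat_uniq us fst_t' ut andbT /=; apply/hasPn => mu.
    case/mapP=> q /tP[nq _] ->; apply/negP => /mapP[r /sP[cr _] qr].
    by case: nq; rewrite qr.
  + move=> q; rewrite mem_cat => /orP[/sP[]//|/mapP[r /tP[_ Ur] ->]] /=.
    by rewrite -scaleN1r; exact: weight_spaceZ.
  + by rewrite big_cat big_map /= def_v sumrN subrr.
  + by rewrite mem_cat sp.
- move=> v; elim/sumset_ind: v / (weight_decomposition v).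
  + by exists 0, 0; split; [exact: sumset0 | exact: sumset0 | rewrite addr0].
  + move=> _ _ [a [b [Aa Bb ->]]] [a' [b' [Aa' Bb' ->]]].
    by exists (a + a'), (b + b'); split; [exact: sumsetD..|rewrite addrACA].
  + move=> w [mu Uw]; have [cmu|ncmu] := pselect (coset lam mu).
      exists w, 0; split; [exact: coset_sum_in Uw|exact: sumset0|].
      by rewrite addr0.
    exists 0, w; split; [exact: sumset0|exact: coset_sum_in Uw|].
    by rewrite add0r.
- case: w0_neq0; apply: A0; apply: coset_sum_in Uw0.
  by exists 0; rewrite wshift0.
elim/sumset_ind: v / (weight_decomposition v) => [|u w|w [mu Uw]].
- exact: sumset0.
- exact: sumsetD.
have [cmu|ncmu] := pselect (coset lam mu); first exact: coset_sum_in Uw.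
by rewrite (B0 w); [exact: sumset0 | exact: coset_sum_in Uw].
Qed.

End JetModule.

(** * The fiber *)

Section Fiber.
Variables (C : numFieldType) (n : nat) (V : lmodType C).
Variables (E : 'rV[int]_n -> {linear V -> V})
          (d : 'I_n -> 'rV[int]_n -> {linear V -> V}).
Hypothesis JV : in_cat_J E d.
Variable lam : 'I_n -> C.
Hypothesis lamV : forall v, coset_sum d (coset lam) v.
Implicit Types (v w : V) (s m : 'rV[int]_n).

Let U := weight_space d lam.

Let EE m k v : E m (E k v) = E (m + k) v.
Proof. by have [[_ ->]] := JV. Qed.

Let E0 v : E 0 v = v.
Proof. by have [[->]] := JV. Qed.

Lemma E_regroup (P : V -> Prop) v :
  P 0 -> (forall u w, P u -> P w -> P (u + w)) ->
  sumset (fun w => exists m, exists2 x, P x & w = E m x) v ->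
  exists s : seq ('rV[int]_n * V), [/\ uniq (map fst s),
    forall p, p \in s -> P p.2 & v = \sum_(p <- s) E p.1 p.2].
Proof.
move=> P0 PD /sumset_label[||s [us sP ->]].
- by move=> m; exists 0; rewrite ?linear0.
- move=> m _ _ [x Px ->] [y Py ->].
  by exists (x + y); rewrite ?linearD //; exact: PD.
exists [seq (p.1, E (- p.1) p.2) | p <- s]; split.
- by rewrite -map_comp.
- by move=> _ /mapP[p /sP[[x Px px] _] ->] /=; rewrite px (E_inv JV).
by rewrite big_map; apply: eq_bigr => p _; rewrite EE subrr E0.
Qed.

(** A vector of weight [lam + m] is [e_m] times its translate by [e_(-m)], which has weight
    [lam]. *)
Lemma fiber_decomposition v : exists s : seq ('rV[int]_n * V),
  [/\ uniq (map fst s), forall p, p \in s -> U p.2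
    & v = \sum_(p <- s) E p.1 p.2].
Proof.
apply: E_regroup; [exact: weight_space0 | exact: weight_spaceD |].
elim/sumset_ind: v / (lamV v) => [|u w|w [mu [m def_mu] Uw]].
- exact: sumset0.
- exact: sumsetD.
apply: sumset_in; exists m, (E (- m) w); last by rewrite EE subrr E0.
move: (weight_space_E JV (- m) Uw).
by rewrite def_mu -wshiftD subrr wshift0.
Qed.

(** The terms have distinct weights [lam + m], so each is zero, and [E m] is invertible. *)
Lemma fiber_indep (s : seq ('rV[int]_n * V)) : uniq (map fst s) ->
  (forall p, p \in s -> U p.2) -> \sum_(p <- s) E p.1 p.2 = 0 ->
  forall p, p \in s -> p.2 = 0.
Proof.
move=> us sU s0 p sp.
suff E_p : E p.1 p.2 = 0 by rewrite -(E_inv JV p.1 p.2) E_p linear0.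
pose t := [seq (q.1, E q.1 q.2) | q <- s].
apply: (@weight_indep _ _ _ d _ (wshift lam) t _ _ _ _ (p.1, E p.1 p.2)).
- exact: wshift_inj.
- by rewrite -map_comp.
- by move=> _ /mapP[q /sU Uq ->]; exact: (weight_space_E JV).
- by rewrite big_map.
- exact: map_f sp.
Qed.

(* The fiber components of an [F]-basis span the fiber: compare terms of weight
   [lam]. *)
Lemma fiber_finite : exists L : seq V,
  (forall w, w \in L -> U w) /\ (forall v, U v -> lspan L v).
Proof.
have [_ _ _ [k [b [_ b_span]]] _] := JV.
have /choice[s sP] := fun r => fiber_decomposition (b r).
pose L := flatten [seq map snd (s r) | r <- enum 'I_k].
have LU w : w \in L -> U w.
  case/flattenP => _ /mapP[r _ ->] /mapP[p sp ->].
  by have [_ sU _] := sP r; exact: sU.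
exists L; split=> // u Uu.
have LspanU w : lspan L w -> U w.
  case=> c ->; apply: weight_space_sum => a _.
  by apply/weight_spaceZ/LU/mem_nth.
have : sumset (fun w => exists m, exists2 x, lspan L x & w = E m x) u.
  have [i [c ->]] := b_span u I.
  elim/big_ind: _ => [|x y|[m r] _]; [exact: sumset0|exact: sumsetD|].
  have [_ _ ->] := sP r; rewrite /= linear_sum scaler_sumr big_seq.
  elim/big_ind: _ => [|x y|p sp]; [exact: sumset0|exact: sumsetD|].
  apply: sumset_in; exists (m + p.1), (c (m, r) *: p.2).
    apply/lspanZ/mem_lspan/flattenP; exists (map snd (s r)).
      by apply: map_f; rewrite mem_enum.
    exact: map_f.
  by rewrite EE linearZ.
case/(E_regroup (lspan0 L) (@lspanD _ _ L)) => t [ut tL def_u].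
pose u0 := \sum_(p <- t | p.1 == 0) p.2.
have Lu0 : lspan L u0.
  rewrite /u0 big_seq_cond; apply: lspan_sum => p /andP[tp _]; exact: tL.
(* Moving [u] to the other side puts [u0 - u] in degree 0 of a vanishing sum, and [fiber_indep] then
   gives [u = u0]. *)
pose t' := (0, u0 - u) :: [seq p <- t | p.1 != 0].
suff : u0 - u = 0 by move/subr0_eq <-.
apply: (@fiber_indep t' _ _ _ (0, u0 - u)) => /=.
- rewrite (subseq_uniq (map_subseq _ (filter_subseq _ _)) ut) andbT.
  by apply/mapP => -[p]; rewrite mem_filter => /andP[/eqP p0 _] /esym.
- move=> p; rewrite inE => /orP[/eqP->|].
    apply: weight_spaceD; first exact: LspanU.
    by rewrite -scaleN1r; exact: weight_spaceZ.
  by rewrite mem_filter => /andP[_ /tL/LspanU].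
- rewrite big_cons big_filter E0 addrAC [X in X - _ = 0](_ : _ = u) ?subrr //.
  rewrite def_u [RHS](bigID (fun p => p.1 == 0)) /=; congr (_ + _).
  by apply: eq_bigr => p /eqP->; rewrite E0.
- exact: mem_head.
Qed.

Lemma fiber_basis : exists (k : nat) (u : 'I_k -> V),
  [/\ forall a, U (u a),
      forall c : 'I_k -> C, \sum_a c a *: u a = 0 -> forall a, c a = 0
    & forall v, U v -> exists c : 'I_k -> C, v = \sum_a c a *: u a].
Proof.
have [L [LU L_span]] := fiber_finite.
have [t [tL t_free Lt]] := lspan_basis L.
exists (size t), (fun a => t`_a); split.
- by move=> a; apply/LU/tL/mem_nth.
- move=> c c0 a; pose c' i := if insub i is Some j then c j else 0.
  have c'E j : c' (val j) = c j by rewrite /c' valK.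
  rewrite -c'E; apply: t_free (ltn_ord a).
  by rewrite -[RHS]c0; apply: eq_bigr => j _; rewrite c'E.
- by move=> v /L_span/(lspan_trans Lt)[c ->]; exists (fun a => c a).
Qed.

Lemma Dop_fiber j s v : U v -> U (Dop E d j s v).
Proof.
move=> Uv; move: (weight_space_E JV (- s) (weight_space_d JV j s Uv)).
by rewrite -wshiftD subrr wshift0.
Qed.

(** The Leibniz rule moves the inner [e_(-m)] past [d_j(s)] at the cost of a multiple of [D_l(m)];
    antisymmetrizing, the [W_n] bracket supplies the terms at [s + m]. *)
Lemma Dop_bracket j l s m v :
  Dop E d j s (Dop E d l m v) - Dop E d l m (Dop E d j s v) =
  zc C m j *: (Dop E d l (s + m) v - Dop E d l m v)
  - zc C s l *: (Dop E d j (s + m) v - Dop E d j s v).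
Proof.
have [_ W _ _ dE] := JV.
have DD i k r q : Dop E d i r (Dop E d k q v) =
    E (- (r + q)) (d i r (d k q v)) - zc C q i *: Dop E d k q v.
  rewrite /Dop dE linearD linearZ /= !EE addrC; congr (_ + _).
    by rewrite opprD.
  by rewrite addrCA addNr addr0 /zc mxE rmorphN scaleNr.
rewrite !DD (addrC m s).
have -> (a b c c' : V) : a - b - (c - c') = (a - c) + (c' - b).
  by rewrite opprB [c' - c]addrC addrACA [- b + _]addrC.
rewrite -linearB W [E _ (_ - _)]linearB.
rewrite [E _ (zc C m j *: _)]linearZ [E _ (zc C s l *: _)]linearZ /=.
rewrite -/(Dop E d l (s + m) v).
rewrite -/(Dop E d j (s + m) v) !scalerBr.
have -> (a b c c' : V) : a - b - (c - c') = a - c + (c' - b).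
  by rewrite opprB [c' - c]addrC addrACA [- b + _]addrC.
by [].
Qed.

Lemma Dop_matrix (k : nat) (u : 'I_k -> V) :
  (forall a, U (u a)) ->
  (forall c : 'I_k -> C, \sum_a c a *: u a = 0 -> forall a, c a = 0) ->
  (forall v, U v -> exists c : 'I_k -> C, v = \sum_a c a *: u a) ->
  exists M : 'I_n -> 'rV[int]_n -> 'M[C]_k,
    (forall j s a, Dop E d j s (u a) = \sum_b M j s b a *: u b) /\
    (forall j l s m, M j s *m M l m - M l m *m M j s =
      (m 0 j)%:~R *: (M l (s + m) - M l m)
      - (s 0 l)%:~R *: (M j (s + m) - M j s)).
Proof.
move=> uU u_free u_span.
have /choice[M0 M0P] : forall js : 'I_n * 'rV[int]_n, exists M : 'M[C]_k,
    forall a, Dop E d js.1 js.2 (u a) = \sum_b M b a *: u b.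
  move=> [j s] /=.
  have /choice[c cP] := fun a => u_span _ (Dop_fiber j s (uU a)).
  exists (\matrix_(b, a) c a b) => a; rewrite cP.
  by apply: eq_bigr => b _; rewrite mxE.
pose M j s := M0 (j, s); exists M.
have MP j s a : Dop E d j s (u a) = \sum_b M j s b a *: u b.
  exact: (M0P (j, s)).
split=> // j l s m.
(* Columns hold images of basis vectors, so matrix products match composition, and matrix identities
   can be tested through [act]. *)
pose act (X : 'M[C]_k) a := \sum_b X b a *: u b.
have act_inj X Y : (forall a, act X a = act Y a) -> X = Y.
  move=> XY; apply/matrixP => b a; apply/eqP; rewrite -subr_eq0; apply/eqP.
  apply: (u_free (fun b => X b a - Y b a)).
  under eq_bigr do rewrite scalerBl.
  by rewrite sumrB -/(act X a) XY subrr.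
have actB X Y a : act (X - Y) a = act X a - act Y a.
  by rewrite -sumrB; apply: eq_bigr => b _; rewrite !mxE scalerBl.
have actZ c X a : act (c *: X) a = c *: act X a.
  by rewrite scaler_sumr; apply: eq_bigr => b _; rewrite mxE scalerA.
have actM i r X a : act (M i r *m X) a = Dop E d i r (act X a).
  rewrite /Dop /act !linear_sum /=.
  under [RHS]eq_bigr => b _ do
    rewrite !linearZ /= -/(Dop E d i r (u b)) MP scaler_sumr.
  rewrite exchange_big; apply: eq_bigr => b _.
  rewrite mxE scaler_suml; apply: eq_bigr => b' _.
  by rewrite scalerA mulrC.
apply: act_inj => a; rewrite !(actB, actZ, actM).
rewrite /act -!MP; exact: Dop_bracket.
Qed.

End Fiber.

(** * From the fiber to the polynomial module *)

Lemma sumset_spans (C : fieldType) (V : lmodType C) (I : eqType)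
    (f : I -> V) v :
  sumset (fun w => exists c, exists i, w = c *: f i) v ->
  exists (s : seq I) (c : I -> C), v = \sum_(i <- s) c i *: f i.
Proof.
move=> v_sum.
have [s ->] : exists s : seq (C * I), v = \sum_(p <- s) p.1 *: f p.2.
  elim/sumset_ind: v / v_sum => [|_ _ [s ->] [t ->]|w [c [i ->]]].
  - by exists [::]; rewrite big_nil.
  - by exists (s ++ t); rewrite big_cat.
  - by exists [:: (c, i)]; rewrite big_seq1.
exists (undup (map snd s)), (fun i => \sum_(p <- s | p.2 == i) p.1).
rewrite (big_regroup snd); apply: eq_bigr => i _.
by rewrite scaler_suml; apply: eq_bigr => p /eqP->.
Qed.

Lemma lin_indep_ord (C : fieldType) (V : lmodType C) (k : nat) (u : 'I_k -> V) :
  (forall c : 'I_k -> C, \sum_a c a *: u a = 0 -> forall a, c a = 0) ->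
  lin_indep u.
Proof.
move=> u_free s c us c0 i si.
have := u_free (fun a => if a \in s then c a else 0) _ i.
rewrite si; apply; rewrite -[RHS]c0 [RHS]big_uniq // [RHS]big_mkcond.
by apply: eq_bigr => a _; case: ifP => //; rewrite scale0r.
Qed.

Lemma fiber_F_basis (C : numFieldType) (n : nat) (V : lmodType C)
    (E : 'rV[int]_n -> {linear V -> V})
    (d : 'I_n -> 'rV[int]_n -> {linear V -> V}) (lam : 'I_n -> C)
    (k : nat) (u : 'I_k -> V) :
  in_cat_J E d -> (forall v, coset_sum d (coset lam) v) ->
  (forall a, weight_space d lam (u a)) ->
  (forall c : 'I_k -> C, \sum_a c a *: u a = 0 -> forall a, c a = 0) ->
  (forall v, weight_space d lam v ->
    exists c : 'I_k -> C, v = \sum_a c a *: u a) ->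
  F_basis E u.
Proof.
move=> JV lamV uU u_free u_span; split=> [s c us c0 [m a] sma|v _].
  (* [c'] is [c] on [s] and 0 elsewhere. Grouping the relation by [m] puts [\sum_a c' m a *: u a] in
     degree [m]; [fiber_indep] kills it and [u_free] finishes. *)
  pose c' m a := \sum_(p <- s | p == (m, a)) c p.
  have <- : c' m a = c (m, a).
    rewrite /c' big_mkcond (bigD1_seq (m, a)) //= eqxx big1 ?addr0 //.
    by move=> p /negbTE->.
  move: a {sma} (map_f fst sma) => a; rewrite -mem_undup /= => sm.
  apply: (u_free (c' m)).
  pose t := [seq (l, \sum_a c' l a *: u a) | l <- undup (map fst s)].
  have tm : (m, \sum_a c' m a *: u a) \in t.
    exact: (map_f (fun l => (l, \sum_a c' l a *: u a)) sm).
  apply: (fiber_indep JV (lam := lam) _ _ _ tm).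
  - by rewrite -map_comp map_id undup_uniq.
  - move=> _ /mapP[l _ ->] /=; apply: weight_space_sum => b _.
    exact: weight_spaceZ.
  rewrite -[RHS]c0 big_map [RHS](big_regroup fst); apply: eq_bigr => l _ /=.
  rewrite linear_sum /=.
  under eq_bigr do rewrite linearZ /= scaler_suml big_mkcond.
  rewrite exchange_big [RHS]big_mkcond; apply: eq_bigr => -[l' b] _ /=.
  case: eqVneq => [->|ll']; last first.
    by rewrite big1 // => b' _; rewrite xpair_eqE (negbTE ll').
  rewrite (bigD1 b) //= eqxx big1 ?addr0 // => b' /negbTE b'b.
  by rewrite xpair_eqE eqxx eq_sym b'b.
apply: sumset_spans.
have [s [_ sU ->]] := fiber_decomposition JV lamV v.
rewrite big_seq; elim/big_ind: _ => [|x y|p /sU/u_span[c ->]].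
- exact: sumset0.
- exact: sumsetD.
rewrite linear_sum; elim/big_ind: _ => [|x y|a _].
- exact: sumset0.
- exact: sumsetD.
by apply: sumset_in; exists (c a), (p.1, a); rewrite linearZ.
Qed.

Lemma Dop_action (C : fieldType) (n : nat) (V : lmodType C)
    (E : 'rV[int]_n -> {linear V -> V})
    (d : 'I_n -> 'rV[int]_n -> {linear V -> V}) j s m v :
  in_cat_J E d ->
  d j s (E m v) = E (m + s) (zc C m j *: v + Dop E d j s v).
Proof.
move=> [[_ EE] _ _ _ dE].
by rewrite dE linearD linearZ /Dop /= EE addrK.
Qed.

Theorem theorem2 (R : realType) (n : nat) (V : lmodType R[i])
    (E : 'rV[int]_n -> {linear V -> V})
    (d : 'I_n -> 'rV[int]_n -> {linear V -> V}) :
  (0 < n)%N ->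
  in_cat_J E d -> indecomposable E d ->
  polynomial_module E d /\
  exists lam : 'I_n -> R[i],
    let U := weight_space d lam in
    (* multiplication F(T^n) (x) U -> J is an isomorphism *)
    ((forall v : V, exists s : seq ('rV[int]_n * V),
        (forall p, p \in s -> U p.2) /\ v = \sum_(p <- s) E p.1 p.2) /\
     (forall s : seq ('rV[int]_n * V), uniq (map fst s) ->
        (forall p, p \in s -> U p.2) -> \sum_(p <- s) E p.1 p.2 = 0 ->
        forall p, p \in s -> p.2 = 0)) /\
    (* D_j(s) is an endomorphism of U *)
    (forall j s v, U v -> U (Dop E d j s v)) /\
    (* the action formula *)
    (forall j s m v, U v ->
        d j s (E m v) = E (m + s) (zc R[i] m j *: v + Dop E d j s v)) /\
    (* U is finite-dimensional, and in a basis of U the matrix of D_j(s)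
       depends polynomially on s *)
    (exists (k : nat) (u : 'I_k -> V),
       [/\ forall a, U (u a), lin_indep u, spans u U &
       exists P : 'I_n -> 'I_k -> 'I_k -> {mpoly R[i][n]},
         forall j s a, Dop E d j s (u a)
           = \sum_(b < k) (P j a b).@[fun i => (s 0 i)%:~R] *: u b]) /\
    (* D_j(0) = lambda_j Id on U *)
    (forall j v, U v -> Dop E d j 0 v = lam j *: v).
Proof.
move=> _ JV indec; have [lam lamV] := single_coset JV indec.
have [k [u [uU u_free u_span]]] := fiber_basis JV lamV.
have [M [MP bracketM]] := Dop_matrix JV uU u_free u_span.
have /choice[P PP] : forall jab : 'I_n * 'I_k * 'I_k,
    exists p : {mpoly R[i][n]}, forall s,
      M jab.1.1 s jab.2 jab.1.2 = p.@[fun i => (s 0 i)%:~R].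
  by move=> [[j a] b]; exact: (bracket_polyfun bracketM).
have DP j s a : Dop E d j s (u a) =
    \sum_(b < k) (P (j, a, b)).@[fun i => (s 0 i)%:~R] *: u b.
  by rewrite MP; apply: eq_bigr => b _; rewrite -(PP (j, a, b)).
split.
  exists k, u; split; first exact: (fiber_F_basis JV lamV).
  (* The summand [m_j Id] of the action formula contributes only on the diagonal. *)
  exists (fun j a b s m =>
    zc _ m j * (b == a)%:R + (P (j, a, b)).@[fun i => (s 0 i)%:~R]).
  split=> [j a b|j s m a].
    (* Of the [n + n] variables, the first block stands for [s] and the second for [m]; [S] places
       the variables of [P] in the first block. *)
    pose S := [tuple 'X_(lshift n i) | i < n] : n.-tuple {mpoly R[i][n + n]}.
    exists ((b == a)%:R *: 'X_(rshift n j) + (P (j, a, b) \mPo S)) => s m.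
    rewrite mevalD mevalZ mevalXU comp_mpoly_meval row_mxEr mulrC.
    congr (_ + _); apply: meval_eq => i.
    by rewrite tnth_mktuple mevalXU row_mxEl.
  rewrite (Dop_action _ _ _ _ JV) DP linearD linear_sum linearZ /=.
  under [RHS]eq_bigr do rewrite scalerDl.
  rewrite big_split /=; congr (_ + _); last first.
    by apply: eq_bigr => b _; rewrite linearZ.
  rewrite (bigD1 a) //= eqxx mulr1 big1 ?addr0 // => b /negbTE->.
  by rewrite mulr0 scale0r.
exists lam => U; split; [split|split; [|split; [|split]]].
- by move=> v; have [s [_ sU ->]] := fiber_decomposition JV lamV v; exists s.
- by move=> s; exact: (fiber_indep JV (lam := lam)).
- by move=> j s v; exact: Dop_fiber.
- by move=> j s m v _; exact: Dop_action.
- exists k, u; split=> //; first exact: lin_indep_ord.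
    move=> v /u_span[c ->]; exists (enum 'I_k), c.
    by rewrite big_enum.
  by exists (fun j a b => P (j, a, b)).
- by move=> j v Uv; have [[E0 _]] := JV; rewrite /Dop oppr0 E0 Uv.
Qed.
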